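(* Let $G$ be a group with a subgroup $H$ isomorphic to $G$ and of finite index $d$, and let $\sigma\colon G\to H$ be an isomorphism. Let $\widetilde G=G*_{\sigma}=\langle G,t\mid \text{relations in }G,\ tgt^{-1}=\sigma(g)\ \text{for all } g\in G\rangle$ be the ascending HNN extension of $G$ with respect to $\sigma$. Then (i) $\widetilde G$ acts on its Bass-Serre tree $T$, which is isomorphic to $\widetilde T_{d+1}$, by automorphisms fixing one of its ends $\omega$. (ii) The action of $\widetilde G$ on $T$ is vertex transitive with the stabilizer of the vertex $\Lambda$ of $T$ corresponding to the coset $1\cdot G$ equal to $G$. (iii) The action of $\widetilde G$ on $T$ is faithful if and only if $\mathrm{Core}(G)=\{1\}$ (equivalently, if $\mathrm{Core}\left(\bigcap_{n=1}^\infty \sigma^n(G)\right)=\{1\}$). In this case $\widetilde G$ embeds into $\mathrm{Aut}(\widetilde T_{d+1})_{\omega}$ as a group acting vertex transitively on $\widetilde T_{d+1}$, and its closure in $\mathrm{Aut}(\widetilde T_{d+1})_{\omega}$ is a scale group. Moreover, the image of $G$ under this embedding coincides with the stabilizer of the distinguished vertex $\Lambda=1\cdot G$ of $T$.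
   Context: The Bass-Serre tree $T$ of $\widetilde G$ has vertex set the left cosets $\{xG: x\in\widetilde G\}$, with an oriented edge from $xG$ to $yG$ if and only if $yG=xt^{-1}G$ (up to replacing $x$ by another representative of its coset); $\widetilde G$ acts by left multiplication. For a subgroup $K\le\widetilde G$, $\mathrm{Core}(K)=\bigcap_{x\in\widetilde G}xKx^{-1}$ is the maximal normal subgroup of $\widetilde G$ contained in $K$. $\widetilde T_{d+1}$ is the (unrooted) $(d+1)$-regular tree. An end is an equivalence class of infinite geodesic rays, two rays being equivalent if they eventually coincide. $\mathrm{Aut}(\widetilde T_{d+1})_\omega$ is the group of automorphisms fixing the end $\omega$, with the topology of pointwise convergence on vertices. A scale group is a closed vertex-transitive subgroup of $\mathrm{Aut}(\widetilde T_{d+1})$ fixing an end. *)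

(* Defs.v *)
From HB Require Import structures.
From mathcomp Require Import all_boot.
From mathcomp Require Import boolp classical_sets functions cardinality topology.

Set Implicit Arguments.
Unset Strict Implicit.
Unset Printing Implicit Defensive.

Local Open Scope classical_set_scope.
Local Open Scope quotient_scope.
Local Open Scope group_scope.

Section Subgroups.
Variable G : groupType.
Implicit Types (K : set G) (x : G).

Definition is_subgroup K := K 1 /\ forall x y, K x -> K y -> K (x * y^-1).

Definition left_coset K x : set G := [set x * k | k in K].

Definition left_cosets K : set (set G) := range (left_coset K).

Definition has_index K (d : nat) := (left_cosets K #= `I_d)%card.

Definition core K : set G := \bigcap_(x : G) [set x * k * x^-1 | k in K].

End Subgroups.

(* A word is a sequence of letters; (x, false) stands for the generator x and
   (x, true) for its formal inverse. *)
Definition word (X : Type) := seq (X * bool).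

Section Presentation.
Variables (X : choiceType) (R : word X -> word X -> Prop).

(* The congruence on words generated by free reduction and the relations
   u = v for R u v; its quotient is the group < X | u = v if R u v >. *)
Inductive presented_eq : word X -> word X -> Prop :=
| presented_rel u v of R u v : presented_eq u v
| presented_cancel x b : presented_eq [:: (x, b); (x, ~~ b)] [::]
| presented_refl u : presented_eq u u
| presented_sym u v of presented_eq u v : presented_eq v u
| presented_trans u v w of presented_eq u v & presented_eq v w :
    presented_eq u w
| presented_cat u u' v v' of presented_eq u u' & presented_eq v v' :
    presented_eq (u ++ v) (u' ++ v').

Definition presented_eqb : rel (word X) := fun u v => `[< presented_eq u v >].

Lemma presented_eqb_refl : reflexive presented_eqb.
Proof. by move=> u; apply/asboolP; exact: presented_refl. Qed.

Lemma presented_eqb_sym : symmetric presented_eqb.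
Proof. by move=> u v; apply/asboolP/asboolP; exact: presented_sym. Qed.

Lemma presented_eqb_trans : transitive presented_eqb.
Proof.
move=> v u w /asboolP uv /asboolP vw.
by apply/asboolP; exact: presented_trans uv vw.
Qed.

Canonical presented_equiv := EquivRel presented_eqb
  presented_eqb_refl presented_eqb_sym presented_eqb_trans.

Definition presented := {eq_quot presented_equiv}.

HB.instance Definition _ := Choice.on presented.

Definition presented_class (u : word X) : presented := \pi_presented u.

Lemma presented_classP u v :
  presented_class u = presented_class v <-> presented_eq u v.
Proof.
by split=> [/eqmodP/asboolP//|uv]; apply/eqmodP/asboolP.
Qed.

Lemma presented_repr (x : presented) : presented_class (repr x) = x.
Proof. exact: reprK. Qed.

Definition inv_word (u : word X) : word X :=
  rev [seq (a.1, ~~ a.2) | a <- u].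

Lemma inv_wordK : involutive inv_word.
Proof.
move=> u; rewrite /inv_word map_rev revK -map_comp -[RHS]map_id.
by apply: eq_map => -[x b] /=; rewrite negbK.
Qed.

Lemma cat_inv_word u : presented_eq (u ++ inv_word u) [::].
Proof.
elim: u => [|[x b] u IH]; first exact: presented_refl.
have -> : ((x, b) :: u) ++ inv_word ((x, b) :: u) =
    [:: (x, b)] ++ (u ++ inv_word u) ++ [:: (x, ~~ b)].
  by rewrite /inv_word /= rev_cons -cats1 catA.
apply: presented_trans (presented_cancel x b).
apply: (@presented_cat _ [:: (x, b)]); first exact: presented_refl.
by apply: presented_cat IH _; exact: presented_refl.
Qed.

Lemma inv_word_eq u v : presented_eq u v ->
  presented_eq (inv_word u) (inv_word v).
Proof.
move=> uv.
have h1 : presented_eq (inv_word u ++ (v ++ inv_word v)) (inv_word u).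
  rewrite -[X in presented_eq _ X]cats0.
  by apply: presented_cat (cat_inv_word v); exact: presented_refl.
apply: presented_trans (presented_sym h1) _; rewrite catA.
rewrite -[X in presented_eq _ X]cat0s.
apply: presented_cat; last exact: presented_refl.
apply: presented_trans (_ : presented_eq _ (inv_word u ++ u)) _.
  by apply: presented_cat; [exact: presented_refl|exact: presented_sym].
by rewrite -{2}[u]inv_wordK; exact: cat_inv_word.
Qed.

Definition presented_one : presented := presented_class [::].
Definition presented_mul (x y : presented) : presented :=
  presented_class (repr x ++ repr y).
Definition presented_inv (x : presented) : presented :=
  presented_class (inv_word (repr x)).

Lemma presented_mulE u v :
  presented_mul (presented_class u) (presented_class v)
  = presented_class (u ++ v).
Proof.
apply/presented_classP; apply: presented_cat; apply/presented_classP;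
exact: presented_repr.
Qed.

Lemma presented_invE u :
  presented_inv (presented_class u) = presented_class (inv_word u).
Proof.
apply/presented_classP/inv_word_eq/presented_classP; exact: presented_repr.
Qed.

Lemma presented_mulA : associative presented_mul.
Proof.
move=> x y z.
by rewrite -(presented_repr x) -(presented_repr y) -(presented_repr z)
  !presented_mulE catA.
Qed.

Lemma presented_mul1 : left_id presented_one presented_mul.
Proof. by move=> x; rewrite -(presented_repr x) presented_mulE. Qed.

Lemma presented_mulr1 : right_id presented_one presented_mul.
Proof. by move=> x; rewrite -(presented_repr x) presented_mulE cats0. Qed.

Lemma presented_mulrV : right_inverse presented_one presented_inv presented_mul.
Proof.
move=> x; rewrite -(presented_repr x) presented_invE presented_mulE.
exact/presented_classP/cat_inv_word.
Qed.

Lemma presented_mulV : left_inverse presented_one presented_inv presented_mul.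
Proof.
move=> x; rewrite -(presented_repr x) presented_invE presented_mulE.
apply/presented_classP; rewrite -{2}[repr x]inv_wordK; exact: cat_inv_word.
Qed.

HB.instance Definition _ := isGroup.Build presented
  presented_mulA presented_mul1 presented_mulr1 presented_mulV presented_mulrV.

Definition presented_gen (x : X) : presented := presented_class [:: (x, false)].

End Presentation.

Section HNN.
Variables (G : groupType) (sigma : G -> G).

(* Generators: Some g for g in G, and None for the stable letter t.  The
   relations in G are given by its multiplication table. *)
Inductive hnn_rel : word (option G) -> word (option G) -> Prop :=
| hnn_rel_mul g h :
    hnn_rel [:: (Some g, false); (Some h, false)] [:: (Some (g * h), false)]
| hnn_rel_conj g :
    hnn_rel [:: (None, false); (Some g, false); (None, true)]
            [:: (Some (sigma g), false)].

Definition hnn : Type := presented hnn_rel.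

HB.instance Definition _ := Group.on hnn.

Definition hnn_base (g : G) : hnn := presented_gen hnn_rel (Some g).

Definition hnn_t : hnn := presented_gen hnn_rel None.

End HNN.

Record graph := Graph { vertex :> choiceType; adj : rel vertex }.

Arguments adj : simpl never.

Section Graphs.
Variable X : graph.

Definition simple_graph := symmetric (@adj X) /\ irreflexive (@adj X).

Definition graph_connected :=
  forall x y : X, exists2 p, path (@adj X) x p & last x p = y.

Definition graph_acyclic :=
  forall s : seq X, (2 < size s)%N -> uniq s -> ~~ cycle (@adj X) s.

Definition is_tree := [/\ simple_graph, graph_connected & graph_acyclic].

Definition is_regular (q : nat) :=
  forall x : X, ([set y | adj x y]%classic #= `I_q)%card.

(* The second clause bounds below the length of every walk from r m to r n. *)
Definition geodesic_ray (r : nat -> X) :=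
  (forall n, adj (r n) (r n.+1)) /\
  (forall m n p, path (@adj X) (r m) p -> last (r m) p = r n ->
    (n - m <= size p)%N).

Definition eventually_coincide (r s : nat -> X) :=
  exists m n, forall k, r (m + k)%N = s (n + k)%N.

Definition is_end (w : set (nat -> X)) :=
  exists2 r, geodesic_ray r &
    w = [set s | geodesic_ray s /\ eventually_coincide r s].

End Graphs.

Definition graph_iso (X Y : graph) (f : X -> Y) :=
  bijective f /\ forall x y, adj (f x) (f y) = adj x y.

Definition end_image (X Y : graph) (f : X -> Y) (w : set (nat -> X)) :
  set (nat -> Y) := [set f \o r | r in w].

Section Automorphisms.
Variable X : graph.

Record aut := Aut {
  aut_fun :> X -> X;
  aut_inv : X -> X;
  aut_funK : cancel aut_fun aut_inv;
  aut_invK : cancel aut_inv aut_fun;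
  aut_adj : forall x y, adj (aut_fun x) (aut_fun y) = adj x y
}.

HB.instance Definition _ := gen_eqMixin aut.
HB.instance Definition _ := gen_choiceMixin aut.

Lemma aut_eq (f g : aut) : f =1 g -> f = g.
Proof.
case: f g => [f f' fK f'K fadj] [g g' gK g'K gadj] /= /funext fg.
move: fK f'K fadj; rewrite fg => fK f'K fadj.
have /funext f'g' : f' =1 g' by move=> x; rewrite -[x in LHS]g'K fK.
move: fK f'K; rewrite f'g' => fK f'K.
by congr Aut; exact: Prop_irrelevance.
Qed.

Lemma aut_isoP (f : X -> X) :
  graph_iso f <-> exists g : aut, f = g.
Proof.
split=> [[[f' fK f'K] fadj]|[g ->]]; first by exists (Aut fK f'K fadj).
by split; [exists (aut_inv g); [exact: aut_funK|exact: aut_invK]|exact: aut_adj].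
Qed.

Definition aut_one : aut :=
  @Aut id id (fun=> erefl) (fun=> erefl) (fun _ _ => erefl).

Definition aut_mul (f g : aut) : aut :=
  @Aut (f \o g) (aut_inv g \o aut_inv f)
    (can_comp (aut_funK f) (aut_funK g)) (can_comp (aut_invK g) (aut_invK f))
    (fun x y => etrans (aut_adj f (g x) (g y)) (aut_adj g x y)).

Lemma aut_inv_adj (f : aut) x y : adj (aut_inv f x) (aut_inv f y) = adj x y.
Proof. by rewrite -(aut_adj f) !aut_invK. Qed.

Definition aut_opp (f : aut) : aut :=
  Aut (aut_invK f) (aut_funK f) (aut_inv_adj f).

Lemma aut_mulA : associative aut_mul.
Proof. by move=> f g h; exact: aut_eq. Qed.

Lemma aut_mul1 : left_id aut_one aut_mul.
Proof. by move=> f; exact: aut_eq. Qed.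

Lemma aut_mulr1 : right_id aut_one aut_mul.
Proof. by move=> f; exact: aut_eq. Qed.

Lemma aut_mulV : left_inverse aut_one aut_opp aut_mul.
Proof. by move=> f; apply: aut_eq => x /=; exact: aut_funK. Qed.

Lemma aut_mulrV : right_inverse aut_one aut_opp aut_mul.
Proof. by move=> f; apply: aut_eq => x /=; exact: aut_invK. Qed.

HB.instance Definition _ :=
  isGroup.Build aut aut_mulA aut_mul1 aut_mulr1 aut_mulV aut_mulrV.

(* Pointwise convergence on vertices, the vertex set being discrete. *)
Definition aut_ptws (f : aut) : {ptws X -> discrete_topology X} := f.

HB.instance Definition _ := Topological.copy aut (initial_topology aut_ptws).

Definition aut_end (w : set (nat -> X)) : set aut :=
  [set f | end_image f w = w].

Definition vertex_transitive (S : set aut) :=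
  forall x y : X, exists2 f, S f & f x = y.

(* The closure of S in aut_end w with its subspace topology. *)
Definition closure_in_aut_end (w : set (nat -> X)) (S : set aut) : set aut :=
  closure S `&` aut_end w.

End Automorphisms.

(* The q-regular tree, as the Cayley graph of the free product of q copies of
   Z/2: vertices are words without two equal consecutive letters, and i :: s
   is adjacent to s. *)
Definition regular_tree (q : nat) : graph :=
  @Graph {s : seq 'I_q | sorted [rel i j | i != j] s}
    (fun u v => [exists i, val v == i :: val u] ||
                [exists i, val u == i :: val v]).

Section RegularTree.
Variable q : nat.
Local Notation V := (regular_tree q).
Implicit Types u v w : V.

Lemma regular_tree_adjP u v :
  reflect ((exists i, val v = i :: val u) \/ (exists i, val u = i :: val v))
          (adj u v).
Proof.
apply: (iffP orP) => -[].
- by move=> /existsP[i /eqP]; left; exists i.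
- by move=> /existsP[i /eqP]; right; exists i.
- by move=> [i uv]; left; apply/existsP; exists i; apply/eqP.
- by move=> [i uv]; right; apply/existsP; exists i; apply/eqP.
Qed.

Lemma regular_tree_simple : simple_graph V.
Proof.
split=> [u v|u]; first by rewrite /adj /= orbC.
by apply/negbTE/negP => /regular_tree_adjP[] [i] /(congr1 size)/= /n_Sn.
Qed.

Lemma regular_tree_connected : graph_connected V.
Proof.
have [Vsym _] := regular_tree_simple.
pose nilV : V := exist _ [::] isT.
have fromnil u : exists2 p, path (@adj V) nilV p & last nilV p = u.
  case: u; elim=> [|i s IH] us; first by exists [::] => //; exact: val_inj.
  have us' : sorted [rel i j | i != j] s by apply: path_sorted us.
  have [p p_path p_last] := IH us'.
  exists (rcons p (exist _ (i :: s) us)); last by rewrite last_rcons.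
  rewrite rcons_path p_path p_last /=; apply/regular_tree_adjP.
  by left; exists i.
have path_sym p : forall u, path (@adj V) u p ->
    exists2 p', path (@adj V) (last u p) p' & last (last u p) p' = u.
  elim: p => [|v p IH] u /=; first by exists [::].
  move=> /andP[uv /IH[p' p'_path p'_last]].
  exists (rcons p' u); last by rewrite last_rcons.
  by rewrite rcons_path p'_path p'_last Vsym.
move=> u v; have [p p_path <-] := fromnil u; have [p' p'_path <-] := fromnil v.
have [r r_path r_last] := path_sym _ _ p_path.
by exists (r ++ p'); rewrite ?cat_path ?last_cat ?r_path r_last.
Qed.

Lemma regular_tree_acyclic : graph_acyclic V.
Proof.
move=> s s_size s_uniq; apply/negP => s_cycle.
have [v vs v_max] : exists2 v, v \in s &
    forall w, w \in s -> (size (val w) <= size (val v))%N.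
  case: s s_size {s_uniq s_cycle} => // v0 s _; elim: s v0 => [|v1 s IH] v0.
    by exists v0; rewrite ?mem_head// => w; rewrite inE => /eqP->.
  have [v vs v_max] := IH v1.
  have [lev|lev] := leqP (size (val v0)) (size (val v)).
    exists v; first by rewrite in_cons vs orbT.
    by move=> w; rewrite in_cons => /orP[/eqP->//|/v_max].
  exists v0; first exact: mem_head.
  move=> w; rewrite in_cons => /orP[/eqP->//|/v_max].
  by move=> /leq_trans -> //; exact: ltnW.
have parent w : w \in s -> adj v w -> exists i, val v = i :: val w.
  move=> /v_max ws /regular_tree_adjP[[i wv]|//].
  by move: ws; rewrite wv ltnn.
have [n s' s's] := rot_to vs.
have mem_s' w : w \in s' -> w \in s.
  by move=> ws'; rewrite -(mem_rot n) s's in_cons ws' orbT.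
have := s_cycle; have := s_uniq; have := s_size.
rewrite -(size_rot n) -(rot_uniq n) -(rot_cycle n) s's.
case/lastP: s' mem_s' {s's} => // -[|a s'] b mem_s' //= _.
rewrite rcons_path mem_rcons => /and3P[_ + _]; rewrite last_rcons.
move=> ab /and3P[va _ bv].
have [i va'] := parent _ (mem_s' _ (mem_head _ _)) va.
have [Vsym _] := regular_tree_simple.
have b_s : b \in s by apply: mem_s'; rewrite mem_rcons mem_head.
have [|j vb'] := parent _ b_s; first by rewrite Vsym.
have /val_inj ab' : val a = val b by move: vb'; rewrite va' => -[].
by move: ab; rewrite ab' mem_head.
Qed.

Lemma regular_tree_regular : is_regular V q.
Proof.
move=> u.
suff [f f_inj f_range] : exists2 f : 'I_q -> V, injective f &
    [set v | adj u v] = range f.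
  have -> : `I_q = range (@nat_of_ord q).
    by apply/seteqP; split=> [k kq|_ [i _ <-]] /=; [exists (Ordinal kq)|].
  rewrite f_range (card_eql (inj_card_eq _)); last by move=> i j _ _; exact: f_inj.
  by rewrite card_eq_sym; apply: inj_card_eq => i j _ _; exact: ord_inj.
have neqSS n : n <> n.+2 by elim: n => // n IH [].
case: u => -[|a s] us.
  exists (fun i => exist _ [:: i] isT); first by move=> i j [].
  apply/seteqP; split=> [v /regular_tree_adjP[[i vi]|[i]]//|_ [i _ <-]].
    by exists i => //; apply: val_inj.
  by apply/regular_tree_adjP; left; exists i.
have us' : sorted [rel i j | i != j] s by apply: path_sorted us.
have ius i : i != a -> sorted [rel i j | i != j] [:: i, a & s] by move=> /= ->.
exists (fun i => if insub [:: i, a & s] is Some v then v else exist _ s us').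
  move=> i j; case: (insubP _ [:: i, a & s]) => [v _ vi|ni];
    case: (insubP _ [:: j, a & s]) => [w _ wj|nj].
  - by move=> vw; move: wj; rewrite -vw vi => -[].
  - by move=> vs; move: vi; rewrite vs /= => /(congr1 size)/= /neqSS.
  - by move=> ws; move: wj; rewrite -ws /= => /(congr1 size)/= /neqSS.
  - move=> _; have ia : i == a by apply: contraNT ni => /ius.
    have ja : j == a by apply: contraNT nj => /ius.
    by rewrite (eqP ia) (eqP ja).
apply/seteqP; split=> [v /regular_tree_adjP[[i vi]|[i [_ vs]]]|_ [i _ <-]].
- exists i => //; move: (valP v); rewrite vi => vsorted.
  by rewrite insubT; apply: val_inj.
- exists a => //; rewrite insubF; first exact: val_inj.
  by rewrite /= eqxx.
- apply/regular_tree_adjP; case: insubP => [v _ vi|_]; first by left; exists i.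
  by right; exists a.
Qed.

Lemma regular_treeP : is_tree V /\ is_regular V q.
Proof.
split; last exact: regular_tree_regular.
split; [exact: regular_tree_simple|exact: regular_tree_connected|].
exact: regular_tree_acyclic.
Qed.

End RegularTree.

Definition scale_group (q : nat) (S : set (aut (regular_tree q))) :=
  [/\ is_subgroup S, closed S, vertex_transitive S &
      exists2 w, is_end w & S `<=` aut_end w].

Section BassSerre.
Variables (G : groupType) (sigma : G -> G).

Definition bs_cosets : set (set (hnn sigma)) :=
  left_cosets (range (hnn_base sigma)).

Definition bs_vertex (x : hnn sigma) : bs_cosets :=
  exist (fun A : set (hnn sigma) => A \in bs_cosets)
    (left_coset (range (hnn_base sigma)) x) (mem_set (imageT _ x)).

(* Oriented edge from xG to x t^-1 G, for every representative x. *)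
Definition bs_edge (u v : bs_cosets) : Prop :=
  exists x, u = bs_vertex x /\ v = bs_vertex (x * (hnn_t sigma)^-1).

Definition bs_tree : graph :=
  @Graph bs_cosets (fun u v => `[< bs_edge u v \/ bs_edge v u >]).

Lemma bs_act_subproof (x : hnn sigma) (u : bs_cosets) :
  [set x * y | y in val u] \in bs_cosets.
Proof.
case: u => u /= /set_mem[y _ <-]; apply/mem_set; exists (x * y) => //.
by rewrite /left_coset [RHS]image_comp; apply: eq_imagel => k _ /=; rewrite mulgA.
Qed.

Definition bs_act (x : hnn sigma) (u : bs_tree) : bs_tree :=
  exist (fun A : set (hnn sigma) => A \in bs_cosets) _ (bs_act_subproof x u).

Definition bs_faithful :=
  forall x, (forall u, bs_act x u = u) -> x = 1.

End BassSerre.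

(* Main.v *)
(* Every vertex xG of T has a single outgoing edge, to its parent x t^-1 G, and
   its children are the vertices x g t G, one for each left coset gH.  The parent
   function has no periodic point, since no positive power of t lies in G, and
   any two vertices have a common ancestor, since every element of the HNN
   extension has the form t^-n g t^m.  Each of these facts about a function p
   gives part of the result: the graph with edges {v, p v} is the regular tree,
   the forward orbits of p define an end, and automorphisms commuting with p fix
   this end.  Commuting with p being a closed condition, the closure of the
   image of the HNN extension still fixes the end. *)
Require Import Defs.
From HB Require Import structures.
From mathcomp Require Import all_boot.
From mathcomp Require Import boolp classical_sets functions cardinality topology.
From mathcomp Require Import ssralg ssrint.

Set Implicit Arguments.
Unset Strict Implicit.
Unset Printing Implicit Defensive.

Local Open Scope classical_set_scope.
Local Open Scope group_scope.

(** * HNN extensions *)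

Section PresentedAction.
Variables (X : choiceType) (R : word X -> word X -> Prop).
Variables (Y : Type) (a a' : X -> Y -> Y).
Hypotheses (aK : forall x, cancel (a x) (a' x)).
Hypotheses (a'K : forall x, cancel (a' x) (a x)).

Definition letter_act (l : X * bool) : Y -> Y := if l.2 then a' l.1 else a l.1.

Definition word_act (u : word X) (y : Y) : Y := foldr letter_act y u.

Lemma word_act_cat u v y : word_act (u ++ v) y = word_act u (word_act v y).
Proof. exact: foldr_cat. Qed.

Hypothesis aR : forall u v, R u v -> word_act u =1 word_act v.

Lemma presented_eq_act u v : presented_eq R u v -> word_act u =1 word_act v.
Proof.
elim=> {u v} [u v /aR//|x [] y|//|u v _ IH y|u v w _ uv _ vw y|].
- exact: aK.
- exact: a'K.
- by rewrite IH.
- by rewrite uv vw.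
- by move=> u u' v v' _ uu' _ vv' y; rewrite !word_act_cat vv' uu'.
Qed.

(** The universal property of a presentation, stated for actions: words equal in the group act alike
    by [presented_eq_act], so the chosen representative is immaterial. *)
Definition presented_act (g : presented R) : Y -> Y := word_act (repr g).

Lemma presented_actE u : presented_act (presented_class R u) =1 word_act u.
Proof. by apply/presented_eq_act/presented_classP; exact: presented_repr. Qed.

Lemma presented_act_gen x : presented_act (presented_gen R x) =1 a x.
Proof. exact: presented_actE. Qed.

Lemma presented_act1 : presented_act 1 =1 id.
Proof. exact: presented_actE. Qed.

Lemma presented_actM g h y :
  presented_act (g * h) y = presented_act g (presented_act h y).
Proof.
rewrite -[g](presented_repr g) -[h](presented_repr h).
rewrite -[_ * _]/(presented_mul _ _) presented_mulE.
by rewrite !presented_actE word_act_cat.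
Qed.

End PresentedAction.

Lemma presented_ind (X : choiceType) (R : word X -> word X -> Prop)
    (P : presented R -> Prop) : P 1 ->
  (forall x g, P g -> P (presented_gen R x * g)) ->
  (forall x g, P g -> P ((presented_gen R x)^-1 * g)) ->
  forall g, P g.
Proof.
move=> P1 Pgen PgenV g; rewrite -(presented_repr g).
elim: (repr g) => [//|[x b] u IH].
rewrite -[_ :: u]/([:: (x, b)] ++ u) -presented_mulE; case: b; last exact: Pgen.
have -> : presented_class R [:: (x, true)] = (presented_gen R x)^-1.
  by rewrite -[RHS]/(presented_inv _) presented_invE.
exact: PgenV.
Qed.

Lemma multiplicative1 (G K : groupType) (f : {multiplicative G -> K}) : f 1 = 1.
Proof. by apply: (mulgI (f 1)); rewrite -gmulfM !mulg1. Qed.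

Lemma multiplicativeV (G K : groupType) (f : {multiplicative G -> K}) :
  {morph f : x / x^-1}.
Proof.
by move=> x; apply: (mulgI (f x)); rewrite -gmulfM !mulgV multiplicative1.
Qed.

Section HNNTheory.
Variables (G : groupType) (sigma : {multiplicative G -> G}).
Local Notation base := (hnn_base sigma).
Local Notation t := (hnn_t sigma).
Implicit Types (x : hnn sigma) (g h : G).

Lemma hnn_baseM g h : base (g * h) = base g * base h.
Proof.
rewrite -[RHS]/(presented_mul _ _) presented_mulE; apply/presented_classP.
exact/presented_sym/presented_rel/hnn_rel_mul.
Qed.

Lemma hnn_base1 : base 1 = 1.
Proof. by apply: (mulgI (base 1)); rewrite -hnn_baseM !mulg1. Qed.

Lemma hnn_baseV g : base g^-1 = (base g)^-1.
Proof. by apply: (mulgI (base g)); rewrite -hnn_baseM !mulgV hnn_base1. Qed.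

Lemma hnn_conj g : t * base g * t^-1 = base (sigma g).
Proof.
pose cl := @presented_class _ (hnn_rel sigma).
rewrite -[LHS]/(presented_mul (presented_mul (cl [:: (None, false)])
  (cl [:: (Some g, false)])) (presented_inv (cl [:: (None, false)]))).
rewrite presented_invE [X in presented_mul X _]presented_mulE presented_mulE.
apply/presented_classP/presented_rel; exact: (hnn_rel_conj sigma g).
Qed.

Lemma hnn_baset g : base g * t^-1 = t^-1 * base (sigma g).
Proof. by rewrite -hnn_conj !mulgA mulVg mul1g. Qed.

Lemma hnn_basetn g n : base g * t^-1 ^+ n = t^-1 ^+ n * base (iter n sigma g).
Proof.
elim: n => [|n IH]; first by rewrite !expg0 mulg1 mul1g.
by rewrite !expgSr mulgA IH -!mulgA hnn_baset.
Qed.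

Lemma hnn_ind (P : hnn sigma -> Prop) : P 1 ->
  (forall g x, P x -> P (base g * x)) ->
  (forall x, P x -> P (t * x)) -> (forall x, P x -> P (t^-1 * x)) ->
  forall x, P x.
Proof.
move=> P1 Pbase Pt PtV; apply: presented_ind => // -[g|] x Px.
- exact: Pbase.
- exact: Pt.
- by rewrite -[presented_gen _ _]/(base g) -hnn_baseV; exact: Pbase.
- exact: PtV.
Qed.

(** Elements of the form [t^-n g t^m] are stable under left multiplication by the generators: a base
    letter crosses [t^-1 ^+ n] at the cost of [iter n sigma], and [t] cancels one factor [t^-1]. *)
Lemma hnn_normal_form x :
  exists m n g, x * t^-1 ^+ m = t^-1 ^+ n * base g.
Proof.
elim/hnn_ind: x => [|h x|x|x].
- by exists 0%N, 0%N, 1; rewrite hnn_base1.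
- move=> [m [n [g xmn]]]; exists m, n, (iter n sigma h * g).
  by rewrite -mulgA xmn mulgA hnn_basetn -mulgA -hnn_baseM.
- move=> [m [[|n] [g xmn]]].
    (* With no [t^-1] left to cancel, one more factor [t^-1] on the right makes the conjugation
       relation applicable. *)
    exists m.+1, 0%N, (sigma g); rewrite expgSr !mulgA -(mulgA t) xmn.
    by rewrite !expg0 !mul1g hnn_conj.
  exists m, n, g; rewrite -mulgA xmn expgS.
  by rewrite -[_^-1 * _ * _]mulgA mulVKg.
- move=> [m [n [g xmn]]]; exists m, n.+1, g.
  by rewrite -mulgA xmn mulgA -expgS.
Qed.

(** The universal property of the HNN extension. Well-chosen actions then separate elements that the
    presentation alone does not visibly distinguish. *)
Lemma hnn_act_exists (Y : Type) (b : G -> Y -> Y) (c c' : Y -> Y) :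
  b 1 =1 id -> (forall g h y, b (g * h) y = b g (b h y)) ->
  cancel c c' -> cancel c' c ->
  (forall g y, c (b g y) = b (sigma g) (c y)) ->
  exists act : hnn sigma -> Y -> Y,
    [/\ act 1 =1 id, forall x x' y, act (x * x') y = act x (act x' y),
        forall g, act (base g) =1 b g & act t =1 c].
Proof.
move=> b1 bM cK c'K cb.
pose a (o : option G) := if o is Some g then b g else c.
pose a' (o : option G) := if o is Some g then b g^-1 else c'.
have aK o : cancel (a o) (a' o).
  by case: o => [g|] y /=; rewrite ?cK// -bM mulVg b1.
have a'K o : cancel (a' o) (a o).
  by case: o => [g|] y /=; rewrite ?c'K// -bM mulgV b1.
have aR u v : hnn_rel sigma u v -> word_act a a' u =1 word_act a a' v.
  case=> [g h|g] y; rewrite /word_act /letter_act /= ?bM//.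
  by rewrite cb c'K.
exists (@presented_act _ (hnn_rel sigma) _ a a'); split.
- exact: presented_act1.
- by move=> *; exact: presented_actM.
- by move=> g; exact: presented_act_gen.
- exact: presented_act_gen.
Qed.

(** The homomorphism to the integers that kills [G] and sends [t] to 1, realised by translations,
    detects the exponent of [t]. *)
Lemma hnn_t_torsion n g : t^-1 ^+ n = base g -> n = 0%N.
Proof.
have [] := @hnn_act_exists int (fun=> id) (fun z => (z + 1)%R)
  (fun z => (z - 1)%R) => // [z|z|act [act1 actM actb actt]].
- by rewrite GRing.addrK.
- by rewrite GRing.subrK.
have acttn z : act (t ^+ n) z = (z + n%:Z)%R.
  elim: n z => [|n IH] z; first by rewrite expg0 act1 GRing.addr0.
  by rewrite expgSr actM IH actt -GRing.addrA -PoszD add1n.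
rewrite expVgn => /(congr1 (fun x => act x 0%R)) /=; rewrite actb.
move=> /(congr1 (act (t ^+ n))); rewrite -actM mulgV act1 acttn.
by rewrite GRing.add0r; case.
Qed.

Hypothesis sigma_inj : injective sigma.

(* [G] acts freely on [G * (nat -> R)], where [R] is a right transversal of the
   image of [sigma], and the shift intertwines this action with its pullback
   along [sigma], so the HNN extension acts too. *)
Lemma hnn_base_inj : injective base.
Proof.
(* A representative of the right coset of [range sigma] through [g]. It depends only on the coset,
   because the set it is picked from does. *)
pose rep g := xget 1 [set r | exists h, g = sigma h * r].
have repP g : exists h, g = sigma h * rep g.
  rewrite /rep; case: xgetP => [r _ //|/(_ g)[]].
  by exists 1; rewrite multiplicative1 mul1g.
have [q qP] := choice repP.
have repE h g : rep (sigma h * g) = rep g.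
  congr xget; apply/seteqP; split=> r [k kr] /=.
    by exists (h^-1 * k); rewrite gmulfM multiplicativeV -mulgA -kr mulKg.
  by exists (h * k); rewrite gmulfM -mulgA kr.
have qE h g : q (sigma h * g) = h * q g.
  by apply: sigma_inj; apply: (mulIg (rep g)); rewrite gmulfM -mulgA -qP
    -(repE h) -qP.
have repK g : rep (rep g) = rep g by rewrite {2}(qP g) repE.
pose I := {r | rep r = r}.
have I_inj (u v : I) : sval u = sval v -> u = v.
  by case: u v => [u uP] [v vP] /= uv; exact: eq_exist.
(* [c] is invertible because every element factors uniquely as [sigma (q g) * rep g]: [c'] splits
   off the representative and pushes it onto the sequence. *)
pose c (y : G * (nat -> I)) := (sigma y.1 * sval (y.2 0%N), y.2 \o S).
pose c' (y : G * (nat -> I)) := (q y.1,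
  fun n => if n is m.+1 then y.2 m else exist _ (rep y.1) (repK y.1) : I).
pose b g (y : G * (nat -> I)) := (g * y.1, y.2).
have [||y|y|g [g' s]|act [_ _ actb _]] := @hnn_act_exists _ b c c'.
- by move=> [g s]; rewrite /b mul1g.
- by move=> g h [g' s]; rewrite /b mulgA.
- case: y => g s; rewrite /c /c' /=; congr (_, _).
    apply: sigma_inj; apply: (mulIg (rep (sigma g * sval (s 0%N)))).
    by rewrite -qP repE (svalP (s 0%N)).
  apply/funext => -[|n] //=; apply: I_inj => /=.
  by rewrite repE (svalP (s 0%N)).
- by case: y => g s; rewrite /c /c' /= -qP.
- by rewrite /c /b /= gmulfM mulgA.
(* Freeness: at a point with first coordinate 1, the action of [base g] produces first coordinate
   [g]. *)
move=> g h gh; pose o : I := exist _ (rep 1) (repK 1).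
have := congr1 (fun x => (act x (1, fun=> o)).1) gh.
by rewrite !actb /= !mulg1.
Qed.

End HNNTheory.

(** * Trees with a parent function *)

Lemma bij_of_surj (A B : choiceType) (f : A -> B) :
  injective f -> (forall b, exists a, f a = b) -> bijective f.
Proof.
move=> f_inj /choice[g fK]; exists g => // a; exact: f_inj.
Qed.

Lemma graph_iso_inv (X Y : graph) (f : X -> Y) : graph_iso f ->
  exists g : Y -> X, [/\ graph_iso g, cancel f g & cancel g f].
Proof.
move=> [[g fK gK] f_adj]; exists g; split=> //; split; first by exists f.
by move=> x y; rewrite -f_adj !gK.
Qed.

Section ParentFunction.
Variables (X : graph) (p : X -> X) (o : X).
Hypothesis adjP : forall u v : X, adj u v <-> p u = v \/ p v = u.
Hypothesis p_aperiodic : forall (v : X) n, iter n.+1 p v <> v.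
Hypothesis p_confluent : forall v, exists m n, iter m p v = iter n p o.

Lemma iter_parent_inj v m n : iter m p v = iter n p v -> m = n.
Proof.
wlog mn : m n / (m <= n)%N => [W|].
  by case: (leqP m n) => [/W//|/ltnW/W h /esym/h].
rewrite -(subnK mn) iterD; case: (n - m)%N => // k /esym/p_aperiodic.
by [].
Qed.

Lemma parent_adj_sym : symmetric (@adj X).
Proof. by move=> u v; apply/idP/idP => /adjP[] h; apply/adjP; auto. Qed.

(** Prepending an upward edge to a walk adds one to [m]; prepending a downward edge cancels one of
    the [m] steps, or adds one to [n] when [m] is 0. This bounds the lengths of walks from below. *)
Lemma path_common_ancestor u q : path (@adj X) u q ->
  exists m n, (m + n <= size q)%N /\ iter m p u = iter n p (last u q).
Proof.
elim: q u => [|v q IH] u /=; first by exists 0%N, 0%N.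
move=> /andP[/adjP uv /IH[m [n [mn vE]]]]; case: uv => [uv|vu].
  by exists m.+1, n; rewrite addSn ltnS mn iterSr uv.
case: m mn vE => [|m] mn vE.
  by exists 0%N, n.+1; rewrite ltnS mn /= -vE.
by exists m, n; rewrite -vE iterSr vu ltnW // ltnS ltnW.
Qed.

(** A walk from level [m] to level [n] gives [a + m = b + n] by aperiodicity, with [a + b] at most
    its length, so [n - m <= a] is bounded by that length. *)
Lemma parent_geodesic_ray : geodesic_ray (fun n => iter n p o).
Proof.
split=> [n|m n q qpath qlast]; first by apply/adjP; left.
have [a [b [ab]]] := path_common_ancestor qpath.
rewrite qlast -!iterD => /iter_parent_inj h.
rewrite leq_subLR; apply: leq_trans (leq_addl b n) _.
by rewrite -h addnC leq_add2l (leq_trans _ ab) // leq_addr.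
Qed.

Definition parent_end : set (nat -> X) :=
  [set s | geodesic_ray s /\ eventually_coincide (fun n => iter n p o) s].

Lemma parent_end_is_end : is_end parent_end.
Proof. by exists (fun n => iter n p o) => //; exact: parent_geodesic_ray. Qed.

Section Enumeration.
Variable d : nat.
Hypothesis fiberP : forall v, ([set u | p u = v] #= `I_d)%card.

Lemma neighbors_enum v : exists c : 'I_d.+1 -> X,
  injective c /\ forall w, adj v w <-> exists i, c i = w.
Proof.
have /card_set_bijP[f [f_lt f_inj f_surj]] := fiberP v.
have /choice[g gP] : forall j : 'I_d, exists u, p u = v /\ f u = j.
  by move=> j; have [u] := f_surj j (ltn_ord j); exists u.
(* Colour 0 is the parent, the other [d] colours are the children. A child equal to the parent would
   give a point of period 2. *)
pose c (i : 'I_d.+1) := if unlift ord0 i is Some j then g j else p v.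
have gNp j : g j <> p v.
  by move=> gp; apply: (@p_aperiodic v 1); rewrite /= -gp (gP j).1.
exists c; split=> [i j|w].
  rewrite /c; case: unliftP => [i'|] ->; case: unliftP => [j'|] -> //.
  - by move=> /(congr1 f); rewrite !(gP _).2 => /val_inj->.
  - by move/gNp.
  - by move/esym/gNp.
rewrite adjP; split=> [[pv|wv]|[i]].
- by exists ord0; rewrite /c unlift_none.
- exists (lift ord0 (Ordinal (f_lt w wv))); rewrite /c liftK.
  by apply: f_inj; rewrite ?inE ?(gP _).2 //=; exact: (gP _).1.
- rewrite /c; case: unliftP => [j|] _ <-; last by left.
  by right; exact: (gP j).1.
Qed.

(** A transposition of colours moves [u] to the prescribed place. A walk needs this to give the edge
    back to the previous vertex the colour just read. *)
Lemma neighbors_enum_at v u i : adj v u -> exists c : 'I_d.+1 -> X,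
  [/\ injective c, forall w, adj v w <-> exists k, c k = w & c i = u].
Proof.
have [c [c_inj cP]] := neighbors_enum v => /cP[j cj].
pose s k := if k == i then j else if k == j then i else k.
have sK : involutive s.
  move=> k; rewrite /s; case: (eqVneq k i) => [->|ki].
    by rewrite eqxx; case: eqVneq.
  case: (eqVneq k j) => [->|kj]; first by rewrite eqxx.
  by rewrite (negbTE ki) (negbTE kj).
exists (c \o s); split=> [|w|]; last by rewrite /= /s eqxx.
  exact: inj_comp (inv_inj sK).
rewrite cP; split=> -[k <-]; first by exists (s k); rewrite /= sK.
by exists (s k).
Qed.

(* Reading a word as a sequence of edge colours: the state is the current
   vertex with a colouring of its neighbours, the last colour read being that
   of the previous vertex. *)
Lemma regular_tree_walk : exists F : seq 'I_d.+1 -> X * ('I_d.+1 -> X),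
  [/\ (F [::]).1 = o,
      forall s, injective (F s).2,
      forall s w, adj (F s).1 w <-> exists k, (F s).2 k = w,
      forall i s, (F (i :: s)).1 = (F s).2 i &
      forall i s, (F (i :: s)).2 i = (F s).1].
Proof.
have [c0 [c0_inj c0P]] := neighbors_enum o.
(* A triple consists of the current vertex, the previous one and the colour just read; [c0] is a
   dummy value for non-adjacent pairs. *)
have /choice[col colP] : forall x : X * X * 'I_d.+1,
    exists c : 'I_d.+1 -> X, adj x.1.1 x.1.2 ->
    [/\ injective c, forall w, adj x.1.1 w <-> exists k, c k = w &
        c x.2 = x.1.2].
  move=> [[v u] i] /=; have [uv|] := boolP (adj v u); last by exists c0.
  by have [c] := neighbors_enum_at i uv; exists c.
pose F := fix F (s : seq 'I_d.+1) := if s is i :: s' then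
  ((F s').2 i, col ((F s').2 i, (F s').1, i)) else (o, c0).
have FP s : injective (F s).2 /\
    forall w, adj (F s).1 w <-> exists k, (F s).2 k = w.
  elim: s => [//|i s [_ IH]] /=.
  have si : adj ((F s).2 i) (F s).1.
    by rewrite parent_adj_sym; apply/IH; exists i.
  by have [] := colP (_, _, i) si.
exists F; split=> // [s|s w|i s]; [by have [] := FP s|by have [] := FP s|].
have si : adj ((F s).2 i) (F s).1.
  by rewrite parent_adj_sym; have [_ ->] := FP s; exists i.
by have [] := colP (_, _, i) si.
Qed.

(** The inverse isomorphism [psi] sends a reduced word to the vertex where its walk from [o]
    ends. *)
Lemma parent_regular_tree : exists phi : X -> regular_tree d.+1, graph_iso phi.
Proof.
have [F [F0 F_inj FP Fi Fprev]] := regular_tree_walk.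
pose ok s := sorted [rel i j : 'I_d.+1 | i != j] s.
pose spine v := exists n, v = iter n p o.
(* A reduced walk first goes up the spine, then leaves it and goes down. *)
have walk i s : ok (i :: s) ->
    (F (i :: s)).1 = iter (size s).+1 p o /\ (F s).1 = iter (size s) p o \/
    ~ spine (F (i :: s)).1 /\ (F s).1 = p (F (i :: s)).1.
  elim: s i => [|j s IH] i.
    move=> _; have /adjP[up|down] : adj (F [::]).1 (F [:: i]).1.
    - by rewrite Fi; apply/FP; exists i.
    - by left; rewrite -up F0.
    - right; split=> // -[n oE]; apply: (@p_aperiodic o n).
      by rewrite /= -oE down F0.
  rewrite {1}/ok /= => /andP[ij js]; have := IH j js.
  set v := (F [:: i, j & s]).1; set u := (F (j :: s)).1.
  have vNs : v <> (F s).1.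
    rewrite /v Fi -(Fprev j s) => /F_inj ijE.
    by rewrite ijE eqxx in ij.
  have : adj u v by rewrite /v Fi; apply/FP; exists i.
  (* Going up from the spine continues it, while going up from outside it would backtrack. A
     downward step ends off the spine, since the only downward edge staying on it also
     backtracks. *)
  move=> /adjP[up|down] [[uE sE]|[uN sE]].
  - by left; rewrite -up uE.
  - by case: vNs; rewrite sE.
  - right; split=> // -[n vE]; apply: vNs; rewrite sE vE.
    move: down; rewrite vE -iterS uE => /iter_parent_inj.
    by case=> ->.
  - right; split=> // -[n vE]; apply: uN; exists n.+1.
    by rewrite -down vE.
have walk_neq0 i s : ok (i :: s) -> (F (i :: s)).1 <> o.
  move=> /walk[[-> _]|[N _]]; first exact: p_aperiodic.
  by move=> vo; apply: N; exists 0%N.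
(* The end vertex determines the previous one, which is its predecessor on the spine or, off the
   spine, its parent; injectivity of the colouring there then recovers the last letter. *)
have walk_inj s s' : ok s -> ok s' -> (F s).1 = (F s').1 -> s = s'.
  elim: s s' => [|i s IH] [|j s'] //; rewrite ?F0.
  - by move=> _ js /esym/(walk_neq0 _ _ js).
  - by move=> oki _ /(walk_neq0 _ _ oki).
  move=> oki js vE.
  have ss' : s = s'.
    apply: IH; [exact: path_sorted oki|exact: path_sorted js|].
    have := walk i s oki; rewrite vE => -[[E ->]|[N ->]];
      have := walk j s' js => -[[E' ->]|[N' ->]] //.
    + by move: E; rewrite E' => /iter_parent_inj[->].
    + by case: N'; rewrite E; eexists.
    + by case: N; rewrite E'; eexists.
  by move: vE; rewrite !Fi -ss' => /F_inj ->.
have walk_adj s w : ok s -> adj (F s).1 w ->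
    exists2 s', ok s' & (F s').1 = w /\
      ((exists i, s' = i :: s) \/ (exists i, s = i :: s')).
  move=> oks /FP[k <-]; case: s oks => [|j s] oks.
    by exists [:: k]; rewrite ?Fi; split=> //; left; exists k.
  have [<-|jk] := eqVneq j k.
    exists s; first exact: path_sorted oks.
    by rewrite Fprev; split=> //; right; exists j.
  exists [:: k, j & s]; first by rewrite /ok /= eq_sym jk.
  by rewrite Fi; split=> //; left; exists k.
pose psi (s : regular_tree d.+1) : X := (F (val s)).1.
have psi_inj : injective psi.
  by move=> s s' /walk_inj h; apply: val_inj; apply: h; exact: valP.
have psi_surj v : exists s, psi s = v.
  suff [s oks <-] : exists2 s, ok s & (F s).1 = v by exists (exist _ s oks).
  have [m [n vE]] := p_confluent v.
  have step u w : (exists2 s, ok s & (F s).1 = u) -> adj u w ->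
      exists2 s, ok s & (F s).1 = w.
    by move=> [s oks <-] /(walk_adj _ _ oks)[s' oks' [<- _]]; exists s'.
  (* From [o], the vertex is reached by [n] steps up and [m] steps down, and the ends of reduced
     walks are closed under adjacency. *)
  elim: m v vE => [|m IH] v; last first.
    by rewrite iterSr => /IH/step; apply; apply/adjP; right.
  move=> /= ->; elim: n => [|n IH]; first by exists [::].
  by apply: (step _ _ IH); apply/adjP; left.
have psi_iso : graph_iso psi.
  split; first exact: bij_of_surj.
  move=> s s'; apply/idP/regular_tree_adjP.
    move=> /(walk_adj _ _ (valP s))[t okt [/walk_inj <- //]].
    exact: valP.
  move=> [] [i E]; [|rewrite parent_adj_sym]; rewrite /psi E Fi;
  by apply/FP; exists i.
by have [phi [phi_iso _ _]] := graph_iso_inv psi_iso; exists phi.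
Qed.

End Enumeration.
End ParentFunction.

(** * Ends *)

Section GraphIsoEnds.
Variables (X Y : graph) (f : X -> Y).
Hypothesis f_iso : graph_iso f.

Lemma graph_iso_path u q : path (@adj Y) (f u) (map f q) = path (@adj X) u q.
Proof. by elim: q u => //= v q IH u; rewrite IH f_iso.2. Qed.

Lemma graph_iso_ray r : geodesic_ray r -> geodesic_ray (f \o r).
Proof.
have [g [_ fK gK]] := graph_iso_inv f_iso.
move=> [r_adj r_geo]; split=> [k|k n q]; first by rewrite /= f_iso.2.
have -> : q = map f (map g q) by rewrite mapK.
rewrite /= graph_iso_path last_map size_map => qpath /(can_inj fK).
exact: r_geo qpath.
Qed.

End GraphIsoEnds.

Lemma end_image_comp (X Y Z : graph) (f : X -> Y) (g : Y -> Z) w :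
  end_image (g \o f) w = end_image g (end_image f w).
Proof. by rewrite /end_image image_comp. Qed.

Lemma graph_iso_end (X Y : graph) (f : X -> Y) w :
  graph_iso f -> is_end w -> is_end (end_image f w).
Proof.
move=> f_iso [r r_geo ->]; exists (f \o r); first exact: graph_iso_ray.
have [g [g_iso fK gK]] := graph_iso_inv f_iso.
apply/seteqP; split=> [_ [s [s_geo [m [n rs]]] <-]|s [s_geo [m [n rs]]]].
  by split; [exact: graph_iso_ray|exists m, n => k; rewrite /= rs].
exists (g \o s); last by apply/funext => k; exact: gK.
split; first exact: graph_iso_ray.
by exists m, n => k; rewrite /= -rs /= fK.
Qed.

Section ParentEnd.
Variables (X : graph) (p : X -> X) (o : X).
Hypothesis p_confluent : forall v, exists m n, iter m p v = iter n p o.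
Local Notation w := (parent_end p o).

(** Such a map carries the parent ray of [o] to that of its image, and these two rays merge by
    confluence. The inverse also commutes with [p], which gives the other inclusion. *)
Lemma parent_end_invariant (f : X -> X) :
  graph_iso f -> (forall v, f (p v) = p (f v)) -> end_image f w = w.
Proof.
have sub (h : X -> X) : graph_iso h -> (forall v, h (p v) = p (h v)) ->
    end_image h w `<=` w.
  move=> h_iso hp _ [s [s_geo [m [n ps]]] <-].
  split; first exact: graph_iso_ray.
  have [a [b ab]] := p_confluent (h o).
  have hpn k v : h (iter k p v) = iter k p (h v) by elim: k => //= k <-.
  exists (m + b)%N, (n + a)%N => k.
  by rewrite /= -!addnA -ps hpn (addnC b) (addnC a) !addnA !iterD ab.
move=> f_iso fp; apply/seteqP; split; first exact: sub.
have [g [g_iso fK gK]] := graph_iso_inv f_iso.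
move=> s ws; exists (g \o s); last by apply/funext => n; exact: gK.
apply: (sub g) => //; last by exists s.
by move=> v; apply: (can_inj fK); rewrite fp !gK.
Qed.

Variables (Y : graph) (phi : X -> Y) (psi : Y -> X).
Hypotheses (phi_iso : graph_iso phi) (psi_iso : graph_iso psi).
Hypotheses (phiK : cancel phi psi) (psiK : cancel psi phi).

Lemma parent_end_aut (f : aut Y) :
  (forall v, f (phi (p (psi v))) = phi (p (psi (f v)))) ->
  aut_end (end_image phi w) f.
Proof.
move=> fp; have /aut_isoP f_iso : exists g : aut Y, f = g :> (Y -> Y).
  by exists f.
pose h := psi \o f \o phi.
have h_iso : graph_iso h.
  split.
    by apply: bij_comp phi_iso.1; apply: bij_comp f_iso.1; case: psi_iso.
  by move=> u v; rewrite psi_iso.2 f_iso.2 phi_iso.2.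
have hw : end_image h w = w.
  apply: parent_end_invariant h_iso _ => v.
  by rewrite /h /= -{1}(phiK v) fp phiK.
rewrite /aut_end /= -end_image_comp -{2}hw -end_image_comp.
by congr end_image; apply/funext => v; rewrite /h /= psiK.
Qed.

End ParentEnd.

(** * Closures of groups of automorphisms *)

Section PointwiseClosure.
Variable X : graph.
Implicit Types (f g : aut X) (S : set (aut X)).

(** Convergence of this filter to [f] says that every pointwise neighbourhood of [f] is detected by
    finitely many vertices. *)
Definition agree_filter (f : X -> X) :
    set_system {ptws X -> discrete_topology X} :=
  [set A | exists l : seq X, forall g : X -> X, {in l, g =1 f} -> A g].

Lemma agree_filter_filter f : Filter (agree_filter f).
Proof.
split=> [|A B [l lA] [m mB]|A B AB [l lA]]; first by exists [::].
- exists (l ++ m) => g fg; split.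
    by apply: lA => v vl; apply: fg; rewrite mem_cat vl.
  by apply: mB => v vm; apply: fg; rewrite mem_cat vm orbT.
- by exists l => g /lA/AB.
Qed.

Lemma agree_filter_cvg f : {ptws, agree_filter f --> aut_ptws f}.
Proof.
have FF := agree_filter_filter f.
apply: (iffRL (@pointwise_cvgP (discrete_topology X) (discrete_topology X)
  _ _ FF)).
move=> v A /nbhs_singleton Afv.
by exists [:: v] => g /(_ v (mem_head _ _)) gf; rewrite /= gf.
Qed.

Lemma eval_nbhs f (v : X) : nbhs f [set g : aut X | g v = f v].
Proof.
have cf : continuous (@aut_ptws X : aut X -> _).
  exact: (@initial_continuous (aut X) _ (@aut_ptws X)).
have nv : nbhs (aut_ptws f) [set g | g v = f v].
  exact: (@proj_continuous X (fun=> discrete_topology X) v (aut_ptws f) _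
    (discrete_set1 (f v : discrete_topology X))).
exact: (cf f _ nv).
Qed.

(** Agreement on a finite list is a finite intersection of evaluation neighbourhoods; conversely
    [agree_filter_cvg] puts such an agreement condition inside any neighbourhood. *)
Lemma closureP S f :
  closure S f <-> forall l : seq X, exists2 g, S g & {in l, g =1 f}.
Proof.
split=> [Sf l|Sf A].
  have : nbhs f [set g : aut X | {in l, g =1 f}].
    elim: l => [|v l IH]; first exact: filterS filterT.
    apply: filterS (filterI (eval_nbhs f v) IH) => g [gv gl] w.
    by rewrite in_cons => /predU1P[->//|/gl].
  by move=> /Sf[g [Sg gl]]; exists g.
move=> [_ [[B oB <-] Bf BA]].
have [l lB] := agree_filter_cvg (open_nbhs_nbhs (conj oB Bf)).
have [g Sg gl] := Sf l; exists g; split=> //; apply: BA; exact: lB.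
Qed.

Lemma closure_subgroup S : is_subgroup S -> is_subgroup (closure S).
Proof.
move=> [S1 SM]; split; first exact: subset_closure.
move=> f g /closureP Sf /closureP Sg; apply/closureP => l.
(* Agreement of [g'] with [g] at the points [aut_inv g v] makes their inverses agree on [l]. *)
have [g' Sg' gg'] := Sg [seq aut_inv g v | v <- l].
have [f' Sf' ff'] := Sf [seq aut_inv g v | v <- l].
exists (f' * g'^-1); first exact: SM.
move=> v vl; have vl' := map_f (aut_inv g) vl; change
  (f' (aut_inv g' v) = f (aut_inv g v)).
have -> : aut_inv g' v = aut_inv g v; last exact: ff'.
by rewrite -{1}(aut_invK g v) -(gg' _ vl') aut_funK.
Qed.

(** Commutation at [v] involves only the values at [v] and [p v], so it passes to pointwise
    limits. *)
Lemma closure_commute S (p : X -> X) :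
  (forall f, S f -> forall v, f (p v) = p (f v)) ->
  forall f, closure S f -> forall v, f (p v) = p (f v).
Proof.
move=> Sp f /closureP Sf v.
have [g /Sp gp gf] := Sf [:: v; p v].
by rewrite -!gf ?gp// !inE eqxx ?orbT.
Qed.

End PointwiseClosure.

(** * The Bass-Serre tree *)

Lemma left_coset_eqP (G : groupType) (K : set G) x y : is_subgroup K ->
  left_coset K x = left_coset K y <-> K (x^-1 * y).
Proof.
move=> [K1 KV].
have KM a b : K a -> K b -> K (a * b).
  by move=> Ka Kb; have := KV _ _ Ka (KV _ _ K1 Kb); rewrite mul1g invgK.
split=> [xy|Kxy].
  have : left_coset K y y by exists 1 => //; rewrite mulg1.
  by rewrite -xy => -[k Kk <-]; rewrite mulKg.
have Kyx : K (y^-1 * x) by have := KV _ _ K1 Kxy; rewrite mul1g invgM invgK.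
apply/seteqP; split=> _ [k Kk <-].
  by exists (y^-1 * x * k); [exact: KM|rewrite !mulgA mulgV mul1g].
by exists (x^-1 * y * k); [exact: KM|rewrite !mulgA mulgV mul1g].
Qed.

(** Both ranges are the quotient of [T] by one equivalence relation. This compares the children of a
    vertex with the left cosets of [H]. *)
Lemma range_card_eq (T : choiceType) (U : Type) (V : pointedType)
    (f : T -> U) (g : T -> V) (x0 : T) :
  (forall x y, f x = f y <-> g x = g y) -> (range f #= range g)%card.
Proof.
move=> fg; apply/card_set_bijP; pose s u := xget x0 [set x | f x = u].
have fsf x : f (s (f x)) = f x by rewrite /s; case: xgetP => [y _ //|/(_ x)[]].
exists (g \o s); split.
- by move=> u _; exact: imageT.
- move=> _ _ /set_mem[x _ <-] /set_mem[y _ <-] /=.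
  by rewrite -fg !fsf.
- by move=> _ [x _ <-]; exists (f x); [exact: imageT|exact/fg].
Qed.

Lemma range_subgroup (G K : groupType) (f : {multiplicative G -> K}) :
  is_subgroup (range f).
Proof.
split; first by exists 1 => //; exact: multiplicative1.
by move=> _ _ [x _ <-] [y _ <-]; exists (x * y^-1) => //;
  rewrite gmulfM multiplicativeV.
Qed.

Lemma multiplicative_exists (G K : groupType) (f : G -> K) :
  {morph f : x y / x * y} -> exists F : {multiplicative G -> K}, F =1 f.
Proof.
move=> fM.
by exists (HB.pack_for (Multiplicative.type G K) f
  (isMultiplicative.Build _ _ f fM)).
Qed.

Section BassSerreTheory.
Variables (G : groupType) (sigma : {multiplicative G -> G}).
Local Notation base := (hnn_base sigma).
Local Notation t := (hnn_t sigma).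
Local Notation vertex := (@bs_vertex G sigma).
Implicit Types (x y : hnn sigma) (u v : bs_tree sigma).

Lemma hnn_base_subgroup : is_subgroup (range base).
Proof.
by have [F /funext FE] := multiplicative_exists (@hnn_baseM G sigma);
  rewrite -FE; exact: range_subgroup.
Qed.

Lemma bs_vertexP x y : vertex x = vertex y <-> range base (x^-1 * y).
Proof.
rewrite -left_coset_eqP; last exact: hnn_base_subgroup.
by split=> [/(congr1 val)//|xy]; exact: val_inj.
Qed.

Lemma bs_vertexM x g : vertex (x * base g) = vertex x.
Proof. by apply/esym/bs_vertexP; rewrite mulKg; exact: imageT. Qed.

Lemma bs_vertex_surj u : exists x, u = vertex x.
Proof.
by case: u => u /[dup] /set_mem[x _ xu] uP; exists x; exact: val_inj.
Qed.

Lemma bs_act_vertex x y : bs_act x (vertex y) = vertex (x * y).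
Proof.
apply: val_inj; rewrite /= /left_coset image_comp.
by apply: eq_imagel => k _ /=; rewrite mulgA.
Qed.

Lemma bs_act1 u : bs_act 1 u = u.
Proof. by have [x ->] := bs_vertex_surj u; rewrite bs_act_vertex mul1g. Qed.

Lemma bs_actM x y u : bs_act (x * y) u = bs_act x (bs_act y u).
Proof. by have [z ->] := bs_vertex_surj u; rewrite !bs_act_vertex mulgA. Qed.

Lemma bs_act_transitive u v : exists x, bs_act x u = v.
Proof.
have [x ->] := bs_vertex_surj u; have [y ->] := bs_vertex_surj v.
by exists (y * x^-1); rewrite bs_act_vertex -mulgA mulVg mulg1.
Qed.

Definition bs_parent u : bs_tree sigma :=
  vertex (projT1 (cid (bs_vertex_surj u)) * t^-1).

(** Independence of the representative: [base g * t^-1] equals [t^-1 * base (sigma g)], whose last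
    factor is absorbed by the coset. *)
Lemma bs_parentE x : bs_parent (vertex x) = vertex (x * t^-1).
Proof.
rewrite /bs_parent; case: cid => y /= /bs_vertexP[g _ gE].
have -> : y = x * base g by rewrite gE mulVKg.
by rewrite -mulgA hnn_baset mulgA bs_vertexM.
Qed.

Lemma iter_bs_parent n x :
  iter n bs_parent (vertex x) = vertex (x * t^-1 ^+ n).
Proof.
elim: n => [|n /= ->]; first by rewrite expg0 mulg1.
by rewrite bs_parentE expgSr mulgA.
Qed.

Lemma bs_parent_act x u : bs_act x (bs_parent u) = bs_parent (bs_act x u).
Proof.
have [y ->] := bs_vertex_surj u.
by rewrite bs_parentE !bs_act_vertex bs_parentE mulgA.
Qed.

Lemma bs_edgeP u v : bs_edge u v <-> bs_parent u = v.
Proof.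
split=> [[x [-> ->]]|<-]; first exact: bs_parentE.
by have [x ->] := bs_vertex_surj u; exists x; rewrite bs_parentE.
Qed.

Lemma bs_adjP u v : adj u v <-> bs_parent u = v \/ bs_parent v = u.
Proof. by rewrite -!bs_edgeP; split=> /asboolP. Qed.

Lemma bs_parent_aperiodic v n : iter n.+1 bs_parent v <> v.
Proof.
have [x ->] := bs_vertex_surj v.
rewrite iter_bs_parent => /esym/bs_vertexP[g _]; rewrite mulKg => /esym.
by move/hnn_t_torsion.
Qed.

Lemma bs_parent_confluent v :
  exists m n, iter m bs_parent v = iter n bs_parent (vertex 1).
Proof.
have [x ->] := bs_vertex_surj v; have [m [n [g xE]]] := hnn_normal_form x.
by exists m, n; rewrite !iter_bs_parent mul1g xE bs_vertexM.
Qed.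

Lemma bs_act_iso x : graph_iso (@bs_act _ sigma x).
Proof.
split.
  exists (@bs_act _ sigma x^-1) => u; by rewrite -bs_actM ?mulgV ?mulVg bs_act1.
have sub y u v : adj u v -> adj (bs_act y u) (bs_act y v).
  by move=> /bs_adjP h; apply/bs_adjP; rewrite -!bs_parent_act;
    case: h => ->; auto.
move=> u v; apply/idP/idP; last exact: sub.
by move=> /(sub x^-1); rewrite -!bs_actM mulVg !bs_act1.
Qed.

Lemma bs_stabilizer :
  [set x | bs_act x (vertex 1) = vertex 1] = range base.
Proof.
apply/seteqP; split=> x /=; rewrite bs_act_vertex mulg1.
  by move=> /esym/bs_vertexP; rewrite invg1 mul1g.
by move=> bx; apply/esym/bs_vertexP; rewrite invg1 mul1g.
Qed.

(** The stabilizer of the vertex of [y] is the conjugate of the base group by [y], and the core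
    intersects these conjugates. *)
Lemma bs_kernelE x : core (range base) x <-> forall u, bs_act x u = u.
Proof.
split=> [xK u|xK y _].
  have [y ->] := bs_vertex_surj u; rewrite bs_act_vertex.
  have [_ [g _ <-] <-] := xK y I.
  by rewrite mulgVK bs_vertexM.
have := xK (vertex y); rewrite bs_act_vertex => /esym/bs_vertexP yxy.
by exists (y^-1 * (x * y)) => //; rewrite !mulgA mulgV mul1g mulgK.
Qed.

Lemma bs_faithfulE : bs_faithful sigma <-> core (range base) = [set 1].
Proof.
split=> [faith|core1 x xK]; last by have /bs_kernelE := xK; rewrite core1.
apply/seteqP; split=> [x /bs_kernelE/faith//|_ ->].
by apply/bs_kernelE; exact: bs_act1.
Qed.

Hypothesis sigma_inj : injective sigma.

Lemma bs_core_intersection :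
  core (range base) = core (base @`
    \bigcap_(n in [set n | (1 <= n)%N]) range (iter n sigma)).
Proof.
apply/seteqP; split=> x xK y _; last first.
  by have [_ [g _ <-] <-] := xK y I; exists (base g) => //; exact: imageT.
have [_ [g _ <-] xE] := xK y I; exists (base g) => //; exists g => // n _.
(* Conjugating by [y * t ^+ n] instead of [y] turns [base h] into [base (iter n sigma h)], so
   injectivity of [base] forces [g = iter n sigma h]. *)
have [_ [h _ <-] xE'] := xK (y * (t^-1 ^+ n)^-1) I.
exists h => //; apply: (hnn_base_inj sigma_inj); apply: (mulgI y).
apply: (mulIg y^-1); rewrite xE -xE' invgM invgK !mulgA; congr (_ * _).
by rewrite -!mulgA hnn_basetn mulKg.
Qed.

(** The children of [xG] are the cosets of [x g t], and those of [g] and [h] coincide exactly when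
    [g^-1 * h] is in [range sigma], that is, in [H]. *)
Lemma bs_parent_fiber (H : set G) d v : is_subgroup H -> has_index H d ->
  H = range sigma -> ([set u | bs_parent u = v] #= `I_d)%card.
Proof.
move=> H_subgroup H_index HE; have [x ->] := bs_vertex_surj v.
apply: card_eq_trans H_index; rewrite card_eq_sym.
have -> : [set u | bs_parent u = vertex x] =
    range (fun g => vertex (x * base g * t)).
  apply/seteqP; split=> [u|_ [g _ <-]] /=; last first.
    by rewrite bs_parentE mulgK bs_vertexM.
  have [y ->] := bs_vertex_surj u; rewrite bs_parentE.
  move=> /esym/bs_vertexP[g _ gE]; exists g => //.
  by rewrite gE mulVKg mulgVK.
rewrite card_eq_sym; apply: (range_card_eq 1) => g h.
rewrite left_coset_eqP// bs_vertexP HE.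
have -> : (x * base g * t)^-1 * (x * base h * t) =
    t^-1 * base (g^-1 * h) * t.
  by rewrite !invgM hnn_baseM hnn_baseV !mulgA mulgVK.
split=> [[k _]|[k _ <-]].
  move=> /(congr1 (fun y => t * y * t^-1)).
  rewrite hnn_conj !mulgA mulgV mul1g mulgK => /(hnn_base_inj sigma_inj) <-.
  exact: imageT.
by exists k => //; rewrite -hnn_conj !mulgA mulVg mul1g mulgVK.
Qed.

End BassSerreTheory.

Theorem theorem6p1 (G : groupType) (H : set G) (d : nat)
    (sigma : {multiplicative G -> G})
    (H_subgroup : is_subgroup H) (H_index : has_index H d)
    (sigma_iso : set_bij [set: G] H sigma) :
  exists w : set (nat -> bs_tree sigma),
  [/\ (* (i) *)
      [/\ exists phi : bs_tree sigma -> regular_tree d.+1, graph_iso phi,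
          forall u v : bs_tree sigma, ~ (bs_edge u v /\ bs_edge v u),
          (forall u : bs_tree sigma, bs_act 1 u = u) /\
            (forall x y (u : bs_tree sigma),
               bs_act (x * y) u = bs_act x (bs_act y u)),
          forall x, graph_iso (@bs_act _ sigma x) &
          is_end w /\ forall x, end_image (@bs_act _ sigma x) w = w],
      (* (ii) *)
      [/\ forall u v : bs_tree sigma, exists x, bs_act x u = v,
          injective (hnn_base sigma) &
          [set x | bs_act x (bs_vertex 1) = bs_vertex 1]
            = range (hnn_base sigma)] &
      (* (iii) *)
      [/\ bs_faithful sigma <-> core (range (hnn_base sigma)) = [set 1],
          core (range (hnn_base sigma)) = [set 1] <->
            core (hnn_base sigma @`
              \bigcap_(n in [set n | (1 <= n)%N]) range (iter n sigma))
              = [set 1] &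
          bs_faithful sigma ->
          forall phi : bs_tree sigma -> regular_tree d.+1, graph_iso phi ->
          exists rho : {multiplicative hnn sigma -> aut (regular_tree d.+1)},
          [/\ forall x u, rho x (phi u) = phi (bs_act x u),
              injective rho,
              range rho `<=` aut_end (end_image phi w) /\
                vertex_transitive (range rho),
              scale_group
                (closure_in_aut_end (end_image phi w) (range rho)) &
              rho @` range (hnn_base sigma) =
                range rho `&`
                [set f : aut (regular_tree d.+1) |
                  f (phi (bs_vertex 1)) = phi (bs_vertex 1)]]]].
Proof.
have [_ sigma_inj' sigma_surj] := sigma_iso.
have sigma_inj : injective sigma.
  by move=> g h; apply: sigma_inj'; exact/mem_set.
have HE : H = range sigma.
  by apply/seteqP; split=> [h /sigma_surj//|_ [g _ <-]];
    case: sigma_iso => + _ _; apply.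
pose p := @bs_parent G sigma; pose o : bs_tree sigma := bs_vertex 1.
have p_fiber v : ([set u | p u = v] #= `I_d)%card.
  exact: (bs_parent_fiber sigma_inj v H_subgroup H_index HE).
have p_aper := @bs_parent_aperiodic G sigma.
have p_conf := @bs_parent_confluent G sigma.
have act_iso := @bs_act_iso G sigma.
exists (parent_end p o); split; split.
- exact: (parent_regular_tree (@bs_adjP G sigma) p_aper p_conf p_fiber).
- by move=> u v [/bs_edgeP <- /bs_edgeP]; exact: (p_aper u 1%N).
- by split; [exact: bs_act1|exact: bs_actM].
- exact: act_iso.
- split; first exact: (parent_end_is_end o (@bs_adjP G sigma) p_aper).
  move=> x; apply: (parent_end_invariant p_conf (act_iso x)).
  exact: bs_parent_act.
- exact: bs_act_transitive.
- exact: hnn_base_inj.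
- exact: bs_stabilizer.
- exact: bs_faithfulE.
- by rewrite -bs_core_intersection.
move=> faith phi phi_iso.
have [psi [psi_iso phiK psiK]] := graph_iso_inv phi_iso.
have /choice[rho0 rho0E] x : exists f : aut (regular_tree d.+1),
    phi \o @bs_act _ sigma x \o psi = f.
  apply/aut_isoP; split.
    by apply: bij_comp psi_iso.1; apply: bij_comp phi_iso.1 (act_iso x).1.
  by move=> u v; rewrite /= phi_iso.2 (act_iso x).2 psi_iso.2.
have [|rho rhoE] := @multiplicative_exists _ _ rho0.
  move=> x y; apply: aut_eq => v.
  change (rho0 (x * y) v = rho0 x (rho0 y v)).
  by rewrite -!rho0E /= phiK bs_actM.
have rhoP x u : rho x (phi u) = phi (bs_act x u) by rewrite rhoE -rho0E /= phiK.
(* The parent function transported along [phi] commutes with the image of [rho], hence with its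
   closure; this is why limits still fix the end. *)
have rho_parent f : range rho f ->
    forall v, f (phi (p (psi v))) = phi (p (psi (f v))).
  move=> [x _ <-] v; rewrite rhoP /p bs_parent_act.
  by rewrite -{2}(psiK v) rhoP phiK.
have fix_end f : closure (range rho) f ->
    aut_end (end_image phi (parent_end p o)) f.
  move=> Sf; apply: (parent_end_aut p_conf phi_iso psi_iso phiK psiK).
  exact: (closure_commute (p := phi \o p \o psi) rho_parent).
have rho_trans : vertex_transitive (range rho).
  move=> u v; have [x xu] := bs_act_transitive (psi u) (psi v).
  by exists (rho x); [exact: imageT|rewrite -(psiK u) rhoP xu psiK].
exists rho; split=> //.
- move=> x y xy; apply/divg1_eq/faith => u; apply: (can_inj phiK).
  by rewrite bs_actM -rhoP xy rhoP -bs_actM mulgV bs_act1.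
- by split=> // f Sf; apply: fix_end; exact: subset_closure.
(* Every limit fixes the end, so the closure inside the end stabilizer is the closure in the full
   automorphism group and is therefore closed there. *)
- have -> : closure_in_aut_end (end_image phi (parent_end p o)) (range rho) =
      closure (range rho) by apply/setIidPl => f; exact: fix_end.
  split.
  + exact/closure_subgroup/range_subgroup.
  + exact: closed_closure.
  + move=> u v; have [f Sf fu] := rho_trans u v.
    by exists f => //; exact: subset_closure.
  + exists (end_image phi (parent_end p o)) => //.
    apply: (graph_iso_end phi_iso).
    exact: (parent_end_is_end o (@bs_adjP G sigma) p_aper).
- rewrite -bs_stabilizer; apply/seteqP; split.
    by move=> _ [x xo <-]; split; [exact: imageT|rewrite /= rhoP xo].
  move=> _ [[x _ <-]]; rewrite /= rhoP => /(can_inj phiK) xo.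
  by exists x.
Qed.
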